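(* Let $\mathcal{G}$ be a finite group and let $s_{\mathcal{G}}:\mathcal{G}\times\mathcal{G}\to\mathcal{G}\times\mathcal{G}$ be the map $s_{\mathcal{G}}(g,h)=(g,g^{-1}h)$. Then $(\mathcal{G},s_{\mathcal{G}})$ is, up to isomorphism, the unique irretractable finite commutative non-degenerate solution whose associated permutation group is isomorphic to $\mathcal{G}$.
   Context: A solution (set-theoretic solution of the Pentagon Equation) is a pair $(S,s)$ with $S$ a non-empty set and $s:S\times S\to S\times S$ a map such that $s_{23}s_{13}s_{12}=s_{12}s_{23}$ as maps $S^3\to S^3$, where $s_{12}=s\times \mathrm{id}$, $s_{23}=\mathrm{id}\times s$, $s_{13}=(\tau\times \mathrm{id})(\mathrm{id}\times s)(\tau\times \mathrm{id})$ and $\tau(x,y)=(y,x)$. Writing $s(x,y)=(x\cdot y,\theta_x(y))$, the pair $(S,s)$ is a solution if and only if for all $x,y,z\in S$: $(x\cdot y)\cdot z=x\cdot(y\cdot z)$, $\theta_x(y)\cdot\theta_{x\cdot y}(z)=\theta_x(y\cdot z)$, and $\theta_{\theta_x(y)}\theta_{x\cdot y}=\theta_y$. It is finite if $S$ is finite. It is commutative if $s_{12}s_{13}=s_{13}s_{12}$, equivalently $x\cdot y\cdot z=x\cdot z\cdot y$ and $\theta_{x\cdot y}=\theta_x$ for all $x,y,z\in S$. It is non-degenerate if every $\theta_x:S\to S$ is bijective. For a non-degenerate solution, the associated permutation group $\mathcal{G}(S,s)$ is the subgroup of $\mathrm{Sym}(S)$ generated by $\{\theta_x: x\in S\}$.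 For a commutative non-degenerate solution, the retract relation is $x\sim y\iff\theta_x=\theta_y$; it induces a solution $\mathrm{Ret}(S,s)$ on $S/\!\sim$ by $\bar s(\bar x,\bar y)=(\overline{x\cdot y},\overline{\theta_x(y)})$. The solution is irretractable if $(S,s)=\mathrm{Ret}(S,s)$, i.e. $\theta_x=\theta_y$ implies $x=y$. Two solutions $(S,s)$, $(T,t)$ are isomorphic if there is a bijection $\phi:S\to T$ with $(\phi\times\phi)s=t(\phi\times\phi)$. *)

(* Defs.v *)
From HB Require Import structures.
From mathcomp Require Import all_boot all_fingroup.

Set Implicit Arguments.
Unset Strict Implicit.
Unset Printing Implicit Defensive.

Section PentagonMaps.
Variables (S : Type) (s : S * S -> S * S).

(* S^3 is represented as (S * S) * S. *)
Definition id_times (f : S * S -> S * S) (t : S * S * S) : S * S * S :=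
  let: (x, y, z) := t in let: (y', z') := f (y, z) in (x, y', z').
Definition times_id (f : S * S -> S * S) (t : S * S * S) : S * S * S :=
  let: (x, y, z) := t in (f (x, y), z).
Definition tau (p : S * S) : S * S := (p.2, p.1).

Definition s12 : S * S * S -> S * S * S := times_id s.
Definition s23 : S * S * S -> S * S * S := id_times s.
Definition s13 : S * S * S -> S * S * S := times_id tau \o id_times s \o times_id tau.

Definition theta (x y : S) : S := (s (x, y)).2.

Definition pentagon_solution : Prop :=
  inhabited S /\ s23 \o s13 \o s12 =1 s12 \o s23.

Definition commutative_solution : Prop := s12 \o s13 =1 s13 \o s12.

Definition non_degenerate : Prop := forall x, bijective (theta x).

Definition retract_rel (x y : S) : Prop := theta x =1 theta y.

(* The canonical map onto the quotient by [retract_rel] is injective, hence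
   identifies the solution with its retract. *)
Definition irretractable : Prop := forall x y, retract_rel x y -> x = y.

End PentagonMaps.

Definition isomorphic_solutions (S T : Type)
    (s : S * S -> S * S) (t : T * T -> T * T) : Prop :=
  exists2 phi : S -> T, bijective phi &
    forall x y, (phi (s (x, y)).1, phi (s (x, y)).2) = t (phi x, phi y).

(* The generators are the permutations equal to some theta_x as functions; for
   a non-degenerate solution every theta_x is one.  The product of {perm S} is
   composition in diagrammatic order, so this is the group with the same
   elements as the usual one and opposite multiplication, isomorphic to it
   through inversion. *)
Definition permutation_group (S : finType) (s : S * S -> S * S) :
    {group {perm S}} :=
  <<[set p : {perm S} | [exists x, [forall y, p y == theta s x y]]]>>%G.

Definition group_solution (gT : finGroupType) (p : gT * gT) : gT * gT :=
  (p.1, (p.1)^-1 * p.2)%g.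

(* Main.v *)
Require Import Defs.
From HB Require Import structures.
From mathcomp Require Import all_boot all_fingroup.

(** Write s (x, y) = (x . y, theta_x y).  Commutativity gives
    theta_(x . y) = theta_x, so irretractability forces x . y = x.  The third
    component of the pentagon equation then becomes
    theta_(theta_x y) o theta_x = theta_y; in the group of permutations, whose
    product is diagrammatic, this reads P (theta_x y) = (P x)^-1 * P y with P x
    the permutation theta_x ([theta_perm_theta]).  Hence the set of all P x is
    nonempty and closed under (a, b) |-> a^-1 * b: it is a subgroup, and so it
    is the whole associated permutation group ([permutation_group_theta]).  By
    irretractability P is a bijection from S onto that group, and the formula
    for P (theta_x y) says that P carries s to the solution
    (g, h) |-> (g, g^-1 * h).  Composing P with an isomorphism onto the given
    group proves uniqueness.

    Applied to the group solution itself, the same description of the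
    permutation group shows that it consists of the left translations
    y |-> x^-1 * y, that is, of the image of an injective morphism. *)

Set Implicit Arguments.
Unset Strict Implicit.
Unset Printing Implicit Defensive.

Local Open Scope group_scope.

Section ThetaPerm.

Variables (S : finType) (s : S * S -> S * S).
Hypothesis s_nd : non_degenerate s.

Definition theta_perm (x : S) : {perm S} := perm (bij_inj (s_nd x)).

Lemma theta_permE x y : theta_perm x y = theta s x y.
Proof. by rewrite permE. Qed.

Lemma theta_perm_generators :
  [set p : {perm S} | [exists x, [forall y, p y == theta s x y]]]
    = theta_perm @: [set: S].
Proof.
apply/setP=> p; rewrite inE; apply/existsP/imsetP=> [[x /forallP px]|[x _ ->]].
  by exists x => //; apply/permP=> y; rewrite theta_permE; apply/eqP.
by exists x; apply/forallP=> y; rewrite theta_permE.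
Qed.

Hypothesis s_irr : irretractable s.

Lemma theta_perm_inj : injective theta_perm.
Proof. by move=> x y eqP; apply: s_irr => z; rewrite -!theta_permE eqP. Qed.

Hypothesis s_comm : commutative_solution s.

(** Commutativity makes [(s (x, y)).1] and [x] equal in the retract. *)
Lemma solution_fst x y : (s (x, y)).1 = x.
Proof.
apply: s_irr => z; have := congr1 snd (s_comm (x, y, z)).
rewrite /s12 /s13 /theta /=.
case: (s (x, y)) => a b /=; case: (s (x, z)) => c d /=.
by case: (s (a, z)) => e f /=.
Qed.

Hypothesis s_pent : pentagon_solution s.

Lemma theta_perm_theta x y :
  theta_perm (theta s x y) = (theta_perm x)^-1 * theta_perm y.
Proof.
apply: (mulgI (theta_perm x)); rewrite mulKVg.
apply/permP=> z; rewrite permM !theta_permE.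
have := congr1 snd (s_pent.2 (x, y, z)); have := solution_fst x y.
rewrite /s12 /s13 /s23 /theta /=.
case: (s (x, y)) => a b /= ->; case: (s (x, z)) => c d /=.
by case: (s (b, d)) => e f /=; case: (s (y, z)) => g h /=.
Qed.

(** A nonempty set closed under (a, b) |-> a^-1 * b is a group, so the
    generators already exhaust the group that they generate. *)
Lemma permutation_group_theta :
  permutation_group s = theta_perm @: [set: S] :> {set {perm S}}.
Proof.
rewrite /permutation_group /= theta_perm_generators; apply: gen_set_id.
have [[x0] _] := s_pent.
(* a^-1 * b at a = b = P x0 puts the identity among the generators. *)
have P1 : theta_perm (theta s x0 x0) = 1 by rewrite theta_perm_theta mulVg.
apply/group_setP; split; first by apply/imsetP; exists (theta s x0 x0).
move=> _ _ /imsetP[x _ ->] /imsetP[y _ ->]; apply/imsetP.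
(* a^-1 * b at (P x, 1) is (P x)^-1, and at ((P x)^-1, P y) it is P x * P y. *)
exists (theta s (theta s x (theta s x0 x0)) y) => //.
by rewrite !theta_perm_theta mulVg mulg1 invgK.
Qed.

Lemma irretractable_isomorphic (gT : finGroupType) :
  permutation_group s \isog [set: gT] ->
  isomorphic_solutions s (@group_solution gT).
Proof.
case/isogP=> f f_inj f_im.
have memP x : theta_perm x \in permutation_group s.
  by rewrite /= permutation_group_theta imset_f.
exists (f \o theta_perm).
  apply: inj_card_bij.
    by move=> x y /= /(injmP f_inj) eqP; apply: theta_perm_inj; apply: eqP.
  rewrite -cardsT -f_im card_injm // permutation_group_theta.
  by rewrite (card_imset _ theta_perm_inj) cardsT.
move=> x y; rewrite /group_solution /= solution_fst -/(theta s x y).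
by rewrite theta_perm_theta morphM ?groupV // morphV.
Qed.

End ThetaPerm.

Section GroupSolution.

Variable gT : finGroupType.
Let s := @group_solution gT.

Lemma group_solution_pentagon : pentagon_solution s.
Proof.
split; first exact: (inhabits 1).
by move=> [[x y] z]; rewrite /s12 /s13 /s23 /= !invMg !invgK !mulgA mulgK.
Qed.

Lemma group_solution_commutative : commutative_solution s.
Proof. by case=> [[x y] z]. Qed.

Lemma group_solution_non_degenerate : non_degenerate s.
Proof. by move=> x; exists (fun y => x * y) => y; rewrite /theta /= (mulKg, mulKVg). Qed.

Lemma group_solution_irretractable : irretractable s.
Proof. by move=> x y /(_ 1); rewrite /theta /= !mulg1 => /invg_inj. Qed.

Let P := theta_perm group_solution_non_degenerate.

(** The inverse in [y |-> x^-1 * y] compensates for the diagrammatic product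
    of permutations, so that this is a morphism and not an antimorphism. *)
Lemma group_theta_permM : {in [set: gT] &, {morph P : x y / x * y}}.
Proof.
move=> x y _ _; apply/permP=> z.
by rewrite permM !theta_permE /theta /= invMg mulgA.
Qed.

Lemma group_solution_permutation_group :
  permutation_group s \isog [set: gT].
Proof.
rewrite isog_sym; apply/isogP; exists (Morphism group_theta_permM).
  by apply/injmP=> x y _ _; apply: (theta_perm_inj group_solution_irretractable).
rewrite morphimEdom /=.
by rewrite (permutation_group_theta group_solution_non_degenerate
  group_solution_irretractable group_solution_commutative
  group_solution_pentagon).
Qed.

End GroupSolution.

Theorem corollary21 (gT : finGroupType) :
  [/\ pentagon_solution (@group_solution gT),
      commutative_solution (@group_solution gT),
      non_degenerate (@group_solution gT),
      irretractable (@group_solution gT) &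
      (permutation_group (@group_solution gT) \isog [set: gT])%g]
  /\
  forall (S : finType) (s : S * S -> S * S),
    pentagon_solution s ->
    commutative_solution s ->
    non_degenerate s ->
    irretractable s ->
    (permutation_group s \isog [set: gT])%g ->
    isomorphic_solutions s (@group_solution gT).
Proof.
split=> [|S s s_pent s_comm s_nd s_irr].
  split.
  - exact: group_solution_pentagon.
  - exact: group_solution_commutative.
  - exact: group_solution_non_degenerate.
  - exact: group_solution_irretractable.
  - exact: group_solution_permutation_group.
exact: irretractable_isomorphic.
Qed.
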